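(* Let $1\le p<\infty$, let $w\in A_p$, and let $f\in RBV^p(\mathbb{R}^n,w)$. Then there is a constant $C>0$, depending only on $p$, $n$ and $[w]_{A_p}$, such that for all $t>0$, $$w\big(\{x\in\mathbb{R}^n: L_f(x)>t\}\big)\le C\Big(\frac{V_p(f;\mathbb{R}^n,w)}{t}\Big)^p.$$
   Context: A weight is a non-negative, locally integrable function $w$ on $\mathbb{R}^n$, and $w(E)=\int_E w(x)\,dx$. For $1<p<\infty$, $w\in A_p$ means $$[w]_{A_p}=\sup_Q \Big(\frac1{|Q|}\int_Q w\,dx\Big)\Big(\frac1{|Q|}\int_Q w^{1/(1-p)}\,dx\Big)^{p-1}<\infty,$$ the supremum being over all cubes $Q\subset\mathbb{R}^n$ with sides parallel to the axes; $w\in A_1$ means $[w]_{A_1}=\sup_Q \operatorname{ess\,sup}_{x\in Q} w(x)^{-1}\frac1{|Q|}\int_Q w\,dx<\infty$. For $f:\mathbb{R}^n\to\mathbb{R}$, the local Lipschitz constant at $x$ is $$L_f(x)=\limsup_{y\to x}\frac{|f(x)-f(y)|}{|x-y|}\in[0,\infty].$$ For $E\subset\mathbb{R}^n$, $\operatorname{osc}_E(f)=\sup_{x,y\in E}|f(x)-f(y)|$. The weighted Riesz $p$-variation of a measurable $f:\mathbb{R}^n\to\mathbb{R}$ is $$V_p(f;\mathbb{R}^n,w)=\sup\Big[\sum_{B_k\in\mathcal{D}}\Big(\frac{\operatorname{osc}_{B_k}(f)}{r_k}\Big)^p w(B_k)\Big]^{1/p},$$ where the supremum is over all countable collections $\mathcal{D}=\{B_k\}$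 of pairwise disjoint open balls $B_k\subset\mathbb{R}^n$ of radius $r_k$. $RBV^p(\mathbb{R}^n,w)$ is the set of measurable $f:\mathbb{R}^n\to\mathbb{R}$ with $V_p(f;\mathbb{R}^n,w)<\infty$. *)

(* Defs.v *)
From HB Require Import structures.
From mathcomp Require Import all_boot all_order all_algebra.
From mathcomp Require Import all_classical all_reals all_analysis.
From mathcomp Require Import ess_sup_inf.
Set Implicit Arguments.
Unset Strict Implicit.
Unset Printing Implicit Defensive.
Import Order.TTheory GRing.Theory Num.Theory.
Import numFieldNormedType.Exports.
Local Open Scope classical_set_scope.
Local Open Scope ring_scope.

(* R^d with d >= 1 is 'rV[R]_n.+1, i.e. d = n.+1.  The norm `|x| of the library
   on row vectors is the sup norm (with the usual topology); the Euclidean norm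
   is [enorm] below. *)

Section lebesgue_outer_measure.
Context (R : realType) (n : nat).
Local Open Scope ereal_scope.
Implicit Types (a b x : 'rV[R]_n.+1) (X : set 'rV[R]_n.+1).

Definition box (ab : 'rV[R]_n.+1 * 'rV[R]_n.+1) : set 'rV[R]_n.+1 :=
  [set x | forall i, (ab.1 ord0 i < x ord0 i < ab.2 ord0 i)%R].

(* The positive part makes the volume of an empty box 0. *)
Definition box_volume (ab : 'rV[R]_n.+1 * 'rV[R]_n.+1) : \bar R :=
  (\prod_(i < n.+1) Num.max 0 (ab.2 ord0 i - ab.1 ord0 i))%:E.

Definition box_cover X : set (nat -> 'rV[R]_n.+1 * 'rV[R]_n.+1) :=
  [set F | X `<=` \bigcup_k box (F k)].

Definition lebesgue_outer X : \bar R :=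
  ereal_inf [set \sum_(k <oo) box_volume (F k) | F in box_cover X].

Lemma box_volume_ge0 ab : 0 <= box_volume ab.
Proof. by rewrite lee_fin prodr_ge0// => i _; rewrite le_max lexx. Qed.

Lemma lebesgue_outer_ge0 X : 0 <= lebesgue_outer X.
Proof.
apply: le_ereal_inf_tmp => _ [F _ <-].
by apply: nneseries_ge0 => *; exact: box_volume_ge0.
Qed.

Lemma le_lebesgue_outer : {homo lebesgue_outer : A B / A `<=` B >-> A <= B}.
Proof.
move=> A B AB; apply/ereal_inf_le_tmp => _ [F BF <-].
by exists F => //; exact: subset_trans AB BF.
Qed.

Lemma lebesgue_outer0 : lebesgue_outer set0 = 0.
Proof.
apply/eqP; rewrite eq_le lebesgue_outer_ge0 andbT.
apply: ereal_inf_lbound; exists (fun=> (0%R, 0%R)); first by move=> x [].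
apply: eseries0 => k _ _.
by rewrite /box_volume big_ord_recl/= subrr maxxx mul0r.
Qed.

Lemma lebesgue_outer_sigma_subadditive : sigma_subadditive lebesgue_outer.
Proof.
move=> A; have [[i ioo]|] := pselect (exists i, lebesgue_outer (A i) = +oo).
  rewrite (eseries_pinfty _ _ ioo) ?leey// => k _.
  by rewrite -ltNye (lt_le_trans _ (lebesgue_outer_ge0 _)).
rewrite -forallNE => Aoo.
suff add2e (e : {posnum R}) : lebesgue_outer (\bigcup_k A k) <=
    \sum_(i <oo) lebesgue_outer (A i) + e%:num%:E.
  by apply/lee_addgt0Pr => _/posnumP[].
rewrite (le_trans _ (epsilon_trick _ _ _))//; last first.
  by move=> k; exact: lebesgue_outer_ge0.
pose P k F := box_cover (A k) F /\ \sum_(j <oo) box_volume (F j) <=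
  lebesgue_outer (A k) + (e%:num / (2 ^ k.+1)%:R)%:E.
have [G PG] : {G & forall k, P k (G k)}.
  apply: (@choice _ _ P) => k; rewrite /P.
  have en1 : (0 < e%:num / (2 ^ k.+1)%:R)%R by [].
  have fA : lebesgue_outer (A k) \is a fin_num.
    by rewrite ge0_fin_numE ?lebesgue_outer_ge0// ltey; apply/eqP.
  have [_ [F AF <-] ltF] := lb_ereal_inf_adherent en1 fA.
  by exists F; split => //; exact/ltW.
have G0 z : 0 <= (box_volume \o uncurry G) z by exact: box_volume_ge0.
apply: (@le_trans _ _ (\esum_(i in setT) (box_volume \o uncurry G) i)).
  apply: ereal_inf_lbound => /=.
  have /card_esym/ppcard_eqP[f] := card_nat2.
  exists (uncurry G \o f).
    move=> t [i _] Ait; have [j _ Gij] := (PG i).1 _ Ait.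
    by exists (f^-1%FUN (i, j)) => //=; rewrite invK ?inE.
  rewrite -(esum_pred_image (box_volume \o uncurry G) _ xpredT)
    ?[fun=> _]set_true//.
  by rewrite image_eq.
rewrite (_ : esum _ _ = \sum_(i <oo) \sum_(j <oo) box_volume (G i j)).
  apply: lee_lim.
  - apply: is_cvg_nneseries => k *.
    by apply: nneseries_ge0 => m *; exact: box_volume_ge0.
  - apply: is_cvg_nneseries => k *.
    by apply: adde_ge0 => //; exact: lebesgue_outer_ge0.
  - by apply: nearW => k; apply: lee_sum => i _; exact: (PG i).2.
pose J : nat -> set (nat * nat) := fun i => [set (i, j) | j in setT].
rewrite (_ : setT = \bigcup_k J k); last first.
  by rewrite predeqE => -[a b]; split => // _; exists a => //; exists b.
rewrite esum_bigcupT /=; last 2 first.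
- apply/trivIsetP => i j _ _ ij.
  rewrite predeqE => -[k m] /=; split => //= -[] [_] _ [<-{k} _].
  by move=> [m' _] [] /esym/eqP; rewrite (negbTE ij).
- by move=> /= [k m]; exact: box_volume_ge0.
rewrite -(image_id [set: nat]) -fun_true esum_pred_image//; last first.
  by move=> k _; apply: esum_ge0 => x _; exact: box_volume_ge0.
apply: eq_eseriesr => /= j _.
rewrite -(esum_pred_image (box_volume \o uncurry G) (pair j) predT)//=; last 2 first.
- by move=> ? _; exact: box_volume_ge0.
- by move=> ? ? _ _; exact: (@can_inj _ _ _ snd).
by congr esum; rewrite predeqE => -[a b]; split; move=> [i _ <-]; exists i.
Qed.

HB.instance Definition _ := isOuterMeasure.Build R 'rV[R]_n.+1 lebesgue_outer
  lebesgue_outer0 lebesgue_outer_ge0 le_lebesgue_outer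
  lebesgue_outer_sigma_subadditive.

End lebesgue_outer_measure.

Section lebesgue_measure_rV.
Context (R : realType) (n : nat).

Let outer : {outer_measure set 'rV[R]_n.+1 -> \bar R} := @lebesgue_outer R n.

(* R^(n.+1) with the sigma-algebra of Lebesgue (i.e. Caratheodory) measurable
   sets, and the (complete) Lebesgue measure on it. *)
Definition lebesgue_type := caratheodory_type outer.

Definition lebesgue : {measure set lebesgue_type -> \bar R} :=
  outer : set (caratheodory_type outer) -> \bar R.

End lebesgue_measure_rV.

Section weights.
Context (R : realType) (n : nat).
Local Open Scope ereal_scope.
Implicit Types (w f : 'rV[R]_n.+1 -> R) (p : R) (E Q : set 'rV[R]_n.+1).

Local Notation mu := (lebesgue R n).

Definition lebesgue_measurable f := measurable_fun [set: lebesgue_type R n] f.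

Definition is_weight w :=
  [/\ forall x, (0 <= w x)%R,
      lebesgue_measurable w &
      forall K : set 'rV[R]_n.+1, compact K ->
        \int[mu]_(x in K) (`|w x|)%:E < +oo].

Definition wmeasure w E : \bar R := \int[mu]_(x in E) (w x)%:E.

Definition cubes : set (set 'rV[R]_n.+1) :=
  [set Q | exists (a : 'rV[R]_n.+1) (l : R), (0 < l)%R /\
    Q = [set x : 'rV[R]_n.+1 |
          forall i, (a ord0 i <= x ord0 i <= a ord0 i + l)%R]].

Definition average (g : 'rV[R]_n.+1 -> \bar R) Q : \bar R :=
  (mu Q)^-1 * \int[mu]_(x in Q) g x.

(* Powers are taken in [0, +oo] so that a negative power of 0 is +oo; a negative
   real power [powR] of 0 would be 0, whence w^(1/(1-p)) is written
   (w^-1)^(1/(p-1)).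
   The extension by 0 in [\_ Q] does not affect the essential supremum since
   w^-1 >= 0. *)
Definition Ap_const p w : \bar R :=
  if p == 1%R then
    ereal_sup [set ess_sup mu ((fun x => (w x)%:E^-1) \_ Q) *
                   average (EFin \o w) Q | Q in cubes]
  else
    ereal_sup [set average (EFin \o w) Q *
                   average (fun x => (w x)%:E^-1 `^ (p - 1)^-1) Q `^ (p - 1)
              | Q in cubes].

Definition Ap p w := is_weight w /\ Ap_const p w < +oo.

End weights.

Section riesz_variation.
Context (R : realType) (n : nat).
Local Open Scope ereal_scope.
Implicit Types (w f : 'rV[R]_n.+1 -> R) (p : R) (x : 'rV[R]_n.+1).

Definition enorm x : R := Num.sqrt (\sum_(i < n.+1) x ord0 i ^+ 2).

Definition eball (b : 'rV[R]_n.+1 * R) : set 'rV[R]_n.+1 :=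
  [set y | (enorm (b.1 - y) < b.2)%R].

Definition local_lip f x : \bar R :=
  limf_esup (fun y => (`|f x - f y| / enorm (x - y))%:E) x^'.

Definition osc f (E : set 'rV[R]_n.+1) : \bar R :=
  ereal_sup [set (`|f z.1 - f z.2|)%:E | z in E `*` E].

(* Balls are given as (center, radius) pairs. *)
Definition ball_families : set (set ('rV[R]_n.+1 * R)) :=
  [set D | [/\ countable D, forall b, D b -> (0 < b.2)%R &
               trivIset D eball]].

Definition riesz_variation p w f : \bar R :=
  ereal_sup [set (\esum_(b in D)
      ((osc f (eball b) / (b.2)%:E) `^ p * wmeasure w (eball b))) `^ p^-1
    | D in ball_families].

Definition RBV p w f :=
  lebesgue_measurable f /\ riesz_variation p w f < +oo.

End riesz_variation.

(* Main.v *)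
Require Import Defs.
From mathcomp Require Import all_boot all_order all_algebra.
From mathcomp Require Import all_classical all_reals all_analysis.
From mathcomp Require Import ess_sup_inf measurable_realfun.
From mathcomp Require Import lra ring.
Set Implicit Arguments.
Unset Strict Implicit.
Unset Printing Implicit Defensive.
Import Order.TTheory GRing.Theory Num.Theory.
Import numFieldNormedType.Exports.
Local Open Scope classical_set_scope.
Local Open Scope ring_scope.

(** Suppose that the local Lipschitz constant of f at x exceeds t.  Then some y
    close to x satisfies |f x - f y| > t |x - y|, so on the Euclidean ball
    centred at x of radius r = 2 |x - y| the ratio osc f / r is at least t / 2
    ([osc_eball_ge]).  Such a ball is worth (t / 2)^p w(B) in a Riesz sum.  Thus
    the weak-type bound follows once the superlevel set is covered by dilates of
    countably many pairwise disjoint balls of this kind and w does not charge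
    the dilates much more than the balls.

    The covering comes from Vitali's selection ([vitali_selection]), applied
    to the closed cubes of half-side r around the points x.  Disjoint cubes
    contain disjoint Euclidean balls, while the centre of a discarded cube lies
    in the threefold dilate of a selected one.

    The comparison of weights is the doubling property of A_p weights
    ([Ap_doubling]): for cubes S inside Q with |Q| <= c |S| one has
    w(Q) <= K (2c)^p w(S), K being the A_p constant of w or any larger number.
    It is applied to the threefold dilate of a selected cube and to a small
    concentric cube inscribed in its Euclidean ball, whose sides differ by the
    factor 6 (n+1).  For p > 1, let s denote the function w^(-1/(p-1)).  The inequality 1 <= l w + l^(-1/(p-1)) s holds pointwise for
    every l > 0, since one of the two terms is at least 1; integrating it over S
    and optimizing in l plays the role of Hoelder's inequality, and stays
    meaningful where w = 0 and s = +oo.  For p = 1, w is bounded below almost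
    everywhere on Q by the inverse of an essential supremum.

    On the side of Lebesgue measure this takes the measurability of cubes, their
    finite measure, and the scaling |c Q| <= c^(n+1) |Q|, all read off from
    coverings by boxes.  A cube of measure zero has null dilates, and doubling
    is then trivial. *)

(** * Lebesgue measure of cubes *)

(** The affine map sends a cover by boxes to a cover by boxes whose volumes are
    multiplied by c^(n+1). *)
Lemma lebesgue_outer_affine_le (R : realType) (n : nat) (a : 'rV[R]_n.+1) (c : R)
    (X : set 'rV[R]_n.+1) : 0 < c ->
  (lebesgue_outer ((fun x => a + c *: x)%R @` X)
    <= (c ^+ n.+1)%:E * lebesgue_outer X)%E.
Proof.
move=> c0; have d0 : 0 < c ^+ n.+1 by rewrite exprn_gt0.
rewrite -lee_pdivrMl//; apply: le_ereal_inf_tmp => _ [F XF <-].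
rewrite lee_pdivrMl// -nneseriesZl; last by move=> *; exact: box_volume_ge0.
pose G k := (a + c *: (F k).1, a + c *: (F k).2).
have -> : (\sum_(0 <= k <oo) ((c ^+ n.+1)%:E * box_volume (F k)) =
    \sum_(0 <= k <oo) box_volume (G k))%E.
  apply: eq_eseriesr => k _; rewrite /box_volume -EFinM; congr EFin.
  rewrite -[X in c ^+ X]card_ord -prodr_const -big_split/=.
  apply: eq_bigr => i _; rewrite !mxE maxr_pMr ?ltW// mulr0; congr Num.max.
  ring.
apply: ereal_inf_lbound; exists G => // _ [x Xx <-].
have [k _ Fkx] := XF _ Xx; exists k => // i; have /andP[? ?] := Fkx i.
by rewrite !mxE !ltrD2l !ltr_pM2l//; apply/andP.
Qed.

Lemma lebesgue_outer_box_lty (R : realType) (n : nat)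
    (ab : 'rV[R]_n.+1 * 'rV[R]_n.+1) : (lebesgue_outer (box ab) < +oo)%E.
Proof.
apply: (@le_lt_trans _ _ (box_volume ab)); last by rewrite ltry.
pose F (k : nat) := if k == 0%N then ab else (0, 0).
have -> : (box_volume ab = \sum_(0 <= k <oo) box_volume (F k))%E.
  rewrite (@nneseriesD1 _ _ 0%N)//; last by move=> *; exact: box_volume_ge0.
  rewrite eseries0 ?adde0// => k _ /= k0.
  rewrite /F (negbTE k0) /box_volume big_ord_recl/= subrr maxxx mul0r//.
by apply: ereal_inf_lbound; exists F => // x abx; exists 0%N.
Qed.

(** Boxes are open, so cutting one along a hyperplane into two boxes that cover
    both closed halves requires an overlap, whose volume can be made as small as
    desired. *)
Lemma box_split (R : realType) (n : nat) (ab : 'rV[R]_n.+1 * 'rV[R]_n.+1)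
    (i : 'I_n.+1) (c e : R) : 0 < e ->
  exists B : ('rV[R]_n.+1 * 'rV[R]_n.+1) * ('rV[R]_n.+1 * 'rV[R]_n.+1),
  [/\ box ab `&` [set x | x ord0 i <= c] `<=` box B.1,
      box ab `&` [set x | c <= x ord0 i] `<=` box B.2 &
      (box_volume B.1 + box_volume B.2 <= box_volume ab + e%:E)%E].
Proof.
case: ab => a b e0.
pose upd (v : 'rV[R]_n.+1) t : 'rV[R]_n.+1 :=
  \row_j (if j == i then t else v ord0 j).
pose V := \prod_(j < n.+1 | j != i) Num.max 0 (b ord0 j - a ord0 j).
have V0 : 0 <= V by apply: prodr_ge0 => j _; rewrite le_max lexx.
have [d d0 dV] : exists2 d, 0 < d & 2 * d * V <= e.
  (* V may vanish, hence the V + 1 in the denominator. *)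
  exists (e / (2 * (V + 1))); first by rewrite divr_gt0// mulr_gt0// ltr_wpDl.
  rewrite [leLHS](_ : _ = e * (V / (V + 1))); last by field; lra.
  by rewrite ler_piMr ?(ltW e0)// ler_pdivrMr ?mul1r; lra.
exists ((a, upd b (Num.min (b ord0 i) (c + d))),
        (upd a (Num.max (a ord0 i) (c - d)), b)); split => /=.
- move=> x [/= abx xc] j; rewrite /= !mxE; have /= /andP[ax xb] := abx j.
  rewrite ax/=; case: eqP => // ji; subst j.
  by rewrite lt_min xb/=; lra.
- move=> x [/= abx xc] j; rewrite /= !mxE; have /= /andP[ax xb] := abx j.
  rewrite xb andbT; case: eqP => // ji; subst j.
  by rewrite gt_max ax/=; lra.
rewrite /box_volume/= -!EFinD lee_fin.
have D1 (F : 'I_n.+1 -> R) : \prod_j F j = F i * \prod_(j | j != i) F j.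
  by rewrite (bigD1 i).
rewrite !D1 !mxE eqxx.
have E1 : \prod_(j < n.+1 | j != i)
    Num.max 0 (upd b (Num.min (b ord0 i) (c + d)) ord0 j - a ord0 j) = V.
  by apply: eq_bigr => j /negbTE ji; rewrite mxE ji.
have E2 : \prod_(j < n.+1 | j != i)
    Num.max 0 (b ord0 j - upd a (Num.max (a ord0 i) (c - d)) ord0 j) = V.
  by apply: eq_bigr => j /negbTE ji; rewrite mxE ji.
rewrite E1 E2 -/V -mulrDl.
apply: (@le_trans _ _ ((Num.max 0 (b ord0 i - a ord0 i) + 2 * d) * V)); last first.
  by rewrite mulrDl lerD2l.
apply: ler_wpM2r => //.
have minmax (u v : R) :
    Num.max 0 (Num.min v (c + d) - u) + Num.max 0 (v - Num.max u (c - d)) <=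
    Num.max 0 (v - u) + 2 * d.
  have : Num.min v (c + d) <= v by rewrite ge_min lexx.
  have : Num.min v (c + d) <= c + d by rewrite ge_min lexx orbT.
  have : u <= Num.max u (c - d) by rewrite le_max lexx.
  have : c - d <= Num.max u (c - d) by rewrite le_max lexx orbT.
  have : 0 <= Num.max 0 (v - u) by rewrite le_max lexx.
  have : v - u <= Num.max 0 (v - u) by rewrite le_max lexx orbT.
  move: (Num.min v _) (Num.max u _) (Num.max 0 (v - u)) d0.
  clear => m M Z d0.
  by case: (leP 0 (m - u)); case: (leP 0 (v - M)); lra.
exact: minmax.
Qed.

(** The two inclusions say that A is a half-space containing any part of its
    boundary; open and closed half-spaces are treated at once because
    [box_split] covers both closed halves. *)
Lemma halfspace_caratheodory (R : realType) (n : nat) (i : 'I_n.+1) (c : R)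
    (A : set 'rV[R]_n.+1) :
  A `<=` [set x | x ord0 i <= c] -> ~` A `<=` [set x | c <= x ord0 i] ->
  measurable (A : set (lebesgue_type R n)).
Proof.
move=> Ac cA; apply: le_caratheodory_measurable => X.
apply: le_ereal_inf_tmp => _ [F XF <-]; apply/lee_addgt0Pr => e e0.
have e2 k : 0 < e / (2 ^ k.+1)%:R by rewrite divr_gt0// ltr0n expn_gt0.
have [B BP] := choice (fun k => @box_split R n (F k) i c _ (e2 k)).
apply: (le_trans _ (epsilon_trick xpredT _ (ltW e0))); last first.
  by move=> *; exact: box_volume_ge0.
have B1 : (\sum_(0 <= k <oo) (box_volume (B k).1 + box_volume (B k).2) <=
    \sum_(0 <= k <oo) (box_volume (F k) + (e / (2 ^ k.+1)%:R)%:E))%E.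
  apply: lee_nneseries => [k _|k _]; first by rewrite adde_ge0// box_volume_ge0.
  by have [] := BP k.
apply: le_trans B1; rewrite nneseriesD; last 2 first.
  by move=> *; exact: box_volume_ge0.
  by move=> *; exact: box_volume_ge0.
apply: leeD; apply: ereal_inf_lbound.
- exists (fun k => (B k).1) => // x [Xx Ax]; have [k _ Fkx] := XF _ Xx.
  by exists k => //; have [+ _ _] := BP k; apply; split => //; exact: Ac.
- exists (fun k => (B k).2) => // x [Xx Ax]; have [k _ Fkx] := XF _ Xx.
  by exists k => //; have [_ + _] := BP k; apply; split => //; exact: cA.
Qed.

(** The parametrization by centre and half-side makes a cube the closed ball of
    the sup norm, and makes dilation the scaling of the half-side. *)
Definition cube (R : realType) (n : nat) (x : 'rV[R]_n.+1) (r : R) :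
    set 'rV[R]_n.+1 :=
  [set y | forall i, x ord0 i - r <= y ord0 i <= x ord0 i + r].

Lemma measurable_cube (R : realType) (n : nat) (x : 'rV[R]_n.+1) (r : R) :
  measurable (cube x r : set (lebesgue_type R n)).
Proof.
pose H i : set (lebesgue_type R n) :=
  [set y : 'rV[R]_n.+1 | x ord0 i - r <= y ord0 i <= x ord0 i + r].
have -> : cube x r = \bigcap_(i in [set: 'I_n.+1]) H i.
  by apply/seteqP; split => [y yQ i _|y yQ i]; [exact: yQ|exact: (yQ i)].
apply: fin_bigcap_measurable => // i _.
pose L : set (lebesgue_type R n) := [set y : 'rV[R]_n.+1 | y ord0 i < x ord0 i - r].
pose U : set (lebesgue_type R n) := [set y : 'rV[R]_n.+1 | y ord0 i <= x ord0 i + r].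
rewrite [H i](_ : _ = U `\` L); last first.
  apply/seteqP; split => y; rewrite /H /U /L /=.
    by move=> /andP[xy yx]; split=> //; apply/negP; rewrite -leNgt.
  by move=> [-> /negP]; rewrite -leNgt => ->.
apply: measurableD.
  apply: (@halfspace_caratheodory _ _ i (x ord0 i + r)) => y //=.
  by move=> /negP; rewrite -ltNge => /ltW.
apply: (@halfspace_caratheodory _ _ i (x ord0 i - r)) => y /=.
  exact: ltW.
by move=> /negP; rewrite -leNgt.
Qed.

Lemma cube_measure_lty (R : realType) (n : nat) (x : 'rV[R]_n.+1) (r : R) :
  (lebesgue R n (cube x r) < +oo)%E.
Proof.
apply: le_lt_trans (lebesgue_outer_box_lty
  (\row_i (x ord0 i - r - 1), \row_i (x ord0 i + r + 1))).
apply: le_lebesgue_outer => y yQ i; have /= /andP[? ?] := yQ i.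
by rewrite !mxE; lra.
Qed.

Lemma cube_measure_scale (R : realType) (n : nat) (x : 'rV[R]_n.+1) (r c : R) :
  0 < c ->
  (lebesgue R n (cube x (c * r)) <= (c ^+ n.+1)%:E * lebesgue R n (cube x r))%E.
Proof.
move=> c0; apply: le_trans (lebesgue_outer_affine_le ((1 - c) *: x) _ c0).
apply: le_lebesgue_outer => y yQ.
exists (x + c^-1 *: (y - x)).
  move=> i; rewrite !mxE; have /= /andP[xy yx] := yQ i.
  apply/andP; split.
    rewrite lerD2l -(ler_pM2l c0) mulVKf ?gt_eqF// mulrN; lra.
  rewrite lerD2l -(ler_pM2l c0) mulVKf ?gt_eqF//; lra.
rewrite scalerDr scalerA divff ?gt_eqF// scale1r scalerBl scale1r.
by rewrite addrA subrK addrC subrK.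
Qed.

Lemma cube_cubes (R : realType) (n : nat) (x : 'rV[R]_n.+1) (r : R) :
  0 < r -> @cubes R n (cube x r).
Proof.
move=> r0; exists (x - const_mx r), (2 * r); split; first by rewrite mulr_gt0.
apply/seteqP; split => y yQ i; have := yQ i; rewrite !mxE => /andP[? ?]; lra.
Qed.

Lemma compact_cube (R : realType) (n : nat) (x : 'rV[R]_n.+1) (r : R) :
  compact (cube x r).
Proof.
have := @rV_compact _ _ (fun i => `[x ord0 i - r, x ord0 i + r]%classic)
  (fun i => @segment_compact _ _ _).
congr (compact _); apply/seteqP; split => y yQ i; have := yQ i;
  by rewrite /= in_itv/=.
Qed.

(** * Integrals over unions *)

(** The integral of a nonnegative function is a supremum over the simple
    functions below it, so it is monotone even on non-measurable functions.  This allows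
    integrals over sets whose measurability is unknown, such as a superlevel set
    of the local Lipschitz constant. *)
Lemma le_integral_nonneg (d : measure_display) (T : measurableType d)
    (R : realType) (mu : {measure set T -> \bar R}) (f g : T -> \bar R) :
  (forall x, 0 <= f x)%E -> (forall x, f x <= g x)%E ->
  (\int[mu]_x f x <= \int[mu]_x g x)%E.
Proof.
move=> f0 fg; rewrite !ge0_integralTE//; last by move=> x; exact: le_trans (fg x).
apply: ereal_sup_le => _ [h hf <-]; exists h => // x.
exact: le_trans (hf x) (fg x).
Qed.

(** Countable subadditivity: f restricted to X is at most the sum of its
    restrictions to the sets A i, and the sum is integrated term by term. *)
Lemma integral_bigcup_le_esum (d : measure_display) (T : measurableType d)
    (R : realType) (mu : {measure set T -> \bar R}) (I : pointedType)
    (D : set I) (A : I -> set T) (X : set T) (f : T -> \bar R) :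
  countable D -> (forall i, measurable (A i)) ->
  measurable_fun [set: T] f -> (forall x, 0 <= f x)%E ->
  X `<=` \bigcup_(i in D) A i ->
  (\int[mu]_(x in X) f x <= \esum_(i in D) \int[mu]_(x in A i) f x)%E.
Proof.
move=> /countable_bijP[B /card_esym/pcard_eqP[g]] mA mf f0 XA.
rewrite (@reindex_esum _ _ _ B D g); last exact: bij.
rewrite esum_mkcond -nneseries_esumT; last first.
  by move=> k; case: ifPn => // _; exact: integral_ge0.
pose A' k := if k \in B then A (g k) else set0.
have mA' k : measurable (A' k) by rewrite /A'; case: ifPn.
rewrite (eq_eseriesr (g := fun k => \int[mu]_x (f \_ (A' k)) x)%E); last first.
  move=> k _; rewrite -integral_mkcond /A'.
  by case: ifPn => // _; rewrite integral_set0.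
rewrite -integral_nneseries//; last 2 first.
  by move=> k; apply/(measurable_restrictT _ _).1 => //; exact: measurable_funTS.
  by move=> k x _; rewrite patchE; case: ifPn.
rewrite integral_mkcond; apply: le_integral_nonneg => x; rewrite patchE.
  by case: ifPn.
have A0 k : (0 <= (f \_ (A' k)) x)%E by rewrite patchE; case: ifPn.
case: ifPn => [|_]; last by apply: nneseries_ge0 => k _ _; exact: A0.
rewrite inE => /XA[i Di Aix].
have [k Bk gk] : (g @` B) i by rewrite image_eq.
rewrite (@nneseriesD1 _ _ k)//.
have fE : (f \_ (A' k)) x = f x by rewrite patchE /A' (mem_set Bk) gk (mem_set Aix).
by rewrite fE leeDl// nneseries_ge0// => ? _ _; exact: A0.
Qed.

(** * Real inequalities behind the A_p condition *)

Lemma measurable_fun_inve (d : measure_display) (T : measurableType d)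
    (R : realType) (w : T -> R) : (forall x, 0 <= w x) ->
  measurable_fun [set: T] w ->
  measurable_fun [set: T] (fun x => ((w x)%:E^-1)%E).
Proof.
move=> w0 mw.
have -> : (fun x => ((w x)%:E^-1)%E) =
    (fun x => if w x == 0 then +oo%E else (w x `^ (-1))%:E).
  by apply/funext => x; rewrite inver; case: ifPn => // _; rewrite powR_inv1.
apply: measurable_fun_ifT => //; first exact: measurable_fun_eqr.
apply/measurable_EFinP; apply: (measurableT_comp (measurable_powR _)) => //.
Qed.

Lemma powR_inv (R : realType) (x r : R) : 0 <= x -> x^-1 `^ r = x `^ (- r).
Proof. by move=> x0; rewrite -powR_inv1// -powRrM mulN1r. Qed.

(** If l w >= 1 the first term suffices; otherwise 1 / (l w) > 1 and the second
    one does.  At w = 0 the second term is +oo. *)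
Lemma weight_young (R : realType) (w l q : R) : 0 <= w -> 0 < l -> 0 < q ->
  (1 <= (l * w)%:E + (l `^ (- q))%:E * (w%:E^-1 `^ q))%E.
Proof.
move=> w0 l0 q0; have lq0 : 0 < l `^ (- q) by rewrite powR_gt0.
rewrite inver; case: ifPn => [/eqP ->|wn0].
  by rewrite poweRyr ?gt_eqF// gt0_muley ?lte_fin// addey ?leey.
have {wn0} w0 : 0 < w by rewrite lt_neqAle eq_sym wn0.
rewrite poweR_EFin -EFinM -EFinD lee_fin.
have [lw|lw] := leP 1 (l * w).
  by apply: (le_trans lw); rewrite lerDl mulr_ge0// powR_ge0.
have lw0 : 0 < l * w by rewrite mulr_gt0.
have lwV : 1 <= (l * w)^-1 by rewrite invf_ge1// ltW.
rewrite -[leLHS]add0r lerD ?(ltW lw0)//.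
rewrite -(powR_inv _ (ltW l0)).
rewrite -powRM ?invr_ge0 ?(ltW l0) ?(ltW w0)// -invfM.
by rewrite -[leLHS](powRr0 ((l * w)^-1)); apply: ler_powR => //; exact: ltW.
Qed.

(** Here m = |S|, M = |Q|, a = w(S), W = w(Q), and s is the integral over Q of
    w^(-1/(p-1)).  The choice l = (2 s / m)^(p-1) makes the second term of the
    hypothesis equal to m / 2, which gives a lower bound for a; the last
    hypothesis, the A_p condition on Q, gives a matching upper bound for W. *)
Lemma Ap_optimize (R : realType) (p c K m M a W s : R) : 1 < p -> 0 < m ->
  0 < M -> M <= c * m -> 0 <= a -> 0 <= s -> 0 < K ->
  (forall l, 0 < l -> m <= l * a + l `^ (- (p - 1)^-1) * s) ->
  M^-1 * W * (M^-1 * s) `^ (p - 1) <= K ->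
  W <= K * (2 * c) `^ p * a.
Proof.
move=> p1 m0 M0 Mcm a0 s0 K0 H HK.
have q0 : 0 < p - 1 by rewrite subr_gt0.
have c0 : 0 < c by rewrite -(pmulr_lgt0 _ m0) (lt_le_trans M0).
(* If s = 0, small values of l contradict the positivity of m. *)
have {s0} s0 : 0 < s.
  rewrite lt_neqAle s0 andbT; apply/eqP => s00.
  have /H : 0 < m / (2 * (a + 1)) by rewrite divr_gt0// mulr_gt0// ltr_wpDl.
  rewrite -s00 mulr0 addr0.
  apply/negP; rewrite -ltNge.
  rewrite [ltLHS](_ : _ = m * (a / (2 * (a + 1)))); last by field; lra.
  by rewrite gtr_pMr// ltr_pdivrMr; lra.
have ma : m / 2 * (m / (2 * s)) `^ (p - 1) <= a.
  have x0 : 0 < 2 * s / m by rewrite divr_gt0// mulr_gt0.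
  have := H ((2 * s / m) `^ (p - 1)) (powR_gt0 _ x0).
  rewrite -powRrM mulrN divff ?gt_eqF// powR_inv1 ?(ltW x0)//.
  rewrite [_^-1 * s](_ : _ = m / 2); last by field; lra.
  move=> Hm; have {Hm} : m / 2 <= (2 * s / m) `^ (p - 1) * a by lra.
  rewrite -ler_pdivrMl ?powR_gt0// -powRN.
  by rewrite -[m / (2 * s)]invrK invf_div (powR_inv _ (ltW x0)) mulrC.
have sM0 : 0 < M^-1 * s by rewrite mulr_gt0 ?invr_gt0.
have : W <= K * (M * (M / s) `^ (p - 1)).
  move: HK; rewrite -ler_pdivlMr ?powR_gt0// -powRN.
  rewrite ler_pdivrMl// => /le_trans; apply.
  rewrite mulrCA ler_wpM2l ?(ltW K0)// ler_wpM2l ?(ltW M0)//.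
  by rewrite -[M / s]invrK invf_div [s / M]mulrC (powR_inv _ (ltW sM0)).
move=> /le_trans; apply; rewrite -mulrA ler_wpM2l ?(ltW K0)//.
apply: (@le_trans _ _ ((2 * c) `^ p * (m / 2 * (m / (2 * s)) `^ (p - 1)))); last first.
  by rewrite ler_wpM2l// powR_ge0.
have c20 : 0 < 2 * c by rewrite mulr_gt0.
rewrite -(mulr_powRB1 (ltW c20)); last lra.
have ms0 : 0 < m / (2 * s) by rewrite divr_gt0// mulr_gt0.
rewrite mulrACA -powRM ?(ltW c20) ?(ltW ms0)//.
rewrite [2 * c * (m / 2)](_ : _ = c * m); last by field.
rewrite [2 * c * (m / (2 * s))](_ : _ = c * m / s); last by field; lra.
have s0' := ltW s0; have M0' := ltW M0; have cm0 := le_trans M0' Mcm.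
apply: ler_pM => //; first exact: powR_ge0.
apply: ge0_ler_powR; rewrite ?nnegrE ?divr_ge0//; first exact: ltW.
by rewrite ler_pM2r ?invr_gt0.
Qed.

(** The analogue of [Ap_optimize] for p = 1, where s is the essential supremum of 1 / w
    over Q. *)
Lemma A1_optimize (R : realType) (c K m M a W s : R) : 0 < m -> 0 < M ->
  M <= c * m -> 0 <= a -> 0 < K -> m <= s * a -> s * (M^-1 * W) <= K ->
  W <= K * c * a.
Proof.
move=> m0 M0 Mcm a0 K0 msa HK.
have sa0 : 0 < s * a by exact: lt_le_trans msa.
have {a0} a0 : 0 < a by rewrite lt_neqAle a0 andbT; apply: contraTneq sa0 => <-;
  rewrite mulr0 ltxx.
have s0 : 0 < s by rewrite -(pmulr_lgt0 _ a0).
have c0 : 0 < c by rewrite -(pmulr_lgt0 _ m0) (lt_le_trans M0).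
rewrite -(ler_pM2l s0); apply: (@le_trans _ _ (K * M)).
  by rewrite -ler_pdivrMr// -mulrA [W / M]mulrC.
rewrite [leRHS](_ : _ = K * (c * (s * a))); last by ring.
by rewrite ler_pM2l// (le_trans Mcm)// ler_pM2l.
Qed.

(** * Weights of nested sets *)

Section weight_on_subset.
Context (d : measure_display) (T : measurableType d) (R : realType)
  (mu : {measure set T -> \bar R}) (w : T -> R) (c K : R) (S Q : set T).
Context (K0 : 0 < K) (w0 : forall x, 0 <= w x)
  (mw : measurable_fun [set: T] w) (mS : measurable S) (mQ : measurable Q)
  (SQ : S `<=` Q) (muS0 : (0 < mu S)%E) (muQy : (mu Q < +oo)%E)
  (muQS : (mu Q <= c%:E * mu S)%E)
  (Wy : (\int[mu]_(x in Q) (w x)%:E < +oo)%E).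

Let we0 x : (0 <= (w x)%:E)%E. Proof. by rewrite lee_fin. Qed.

Let mwe : measurable_fun [set: T] (fun x => (w x)%:E).
Proof. exact/measurable_EFinP. Qed.

Let muSQ : (mu S <= mu Q)%E. Proof. by apply: le_measure; rewrite ?inE. Qed.

Let muQ0 : (0 < mu Q)%E. Proof. exact: lt_le_trans muSQ. Qed.

Let muQfin : mu Q \is a fin_num. Proof. by rewrite ge0_fin_numE. Qed.

Let muSfin : mu S \is a fin_num.
Proof. by rewrite ge0_fin_numE// (le_lt_trans muSQ). Qed.

Let M0 : 0 < fine (mu Q). Proof. by rewrite fine_gt0// muQ0. Qed.

Let m0 : 0 < fine (mu S).
Proof. by rewrite fine_gt0// muS0/= (le_lt_trans muSQ). Qed.

Let Mcm : fine (mu Q) <= c * fine (mu S).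
Proof. by rewrite -lee_fin EFinM !fineK. Qed.

Let c0 : 0 < c.
Proof. by rewrite -(pmulr_lgt0 _ m0) (lt_le_trans M0). Qed.

Let Wfin : (\int[mu]_(x in Q) (w x)%:E)%E \is a fin_num.
Proof. by rewrite ge0_fin_numE// integral_ge0. Qed.

Let a0 : (0 <= \int[mu]_(x in S) (w x)%:E)%E.
Proof. exact: integral_ge0. Qed.

Let afin : (\int[mu]_(x in S) (w x)%:E)%E \is a fin_num.
Proof.
rewrite ge0_fin_numE// (le_lt_trans _ Wy)//.
by apply: ge0_subset_integral => //; exact: measurable_funTS.
Qed.

Let average_gt0 : (\int[mu]_(x in Q) (w x)%:E)%E != 0%E ->
  0 < (fine (mu Q))^-1 * fine (\int[mu]_(x in Q) (w x)%:E)%E.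
Proof.
move=> W0; rewrite mulr_gt0 ?invr_gt0// fine_gt0//.
by rewrite Wy andbT lt_neqAle eq_sym W0 integral_ge0.
Qed.

(** The function g = w^(-1/(p-1)) is integrable over Q as soon as w(Q) > 0, by
    the A_p condition.  Then [weight_young] integrated over S and
    [Ap_optimize] conclude. *)
Lemma Ap_integral_subset (p : R) : 1 < p ->
  ((mu Q)^-1 * (\int[mu]_(x in Q) (w x)%:E) *
    ((mu Q)^-1 * (\int[mu]_(x in Q) ((w x)%:E^-1 `^ (p - 1)^-1))) `^ (p - 1)
    <= K%:E)%E ->
  (\int[mu]_(x in Q) (w x)%:E
    <= (K * (2 * c) `^ p)%:E * \int[mu]_(x in S) (w x)%:E)%E.
Proof.
move=> p1 HK; have q0 : 0 < p - 1 by rewrite subr_gt0.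
set g := fun x => ((w x)%:E^-1 `^ (p - 1)^-1)%E.
have g0 x : (0 <= g x)%E by rewrite poweR_ge0.
have mg : measurable_fun [set: T] g.
  apply: (measurableT_comp (measurable_poweR _)).
  exact: measurable_fun_inve.
have sS : (\int[mu]_(x in S) g x <= \int[mu]_(x in Q) g x)%E.
  by apply: ge0_subset_integral => //; exact: measurable_funTS.
have s0 : (0 <= \int[mu]_(x in Q) g x)%E by exact: integral_ge0.
have H l : 0 < l -> (mu S <= l%:E * (\int[mu]_(x in S) (w x)%:E) +
    (l `^ (- (p - 1)^-1))%:E * \int[mu]_(x in S) g x)%E.
  move=> l0.
  have lq0 : (0 <= (l `^ (- (p - 1)^-1))%:E)%E by rewrite lee_fin powR_ge0.
  have le0 : (0 <= l%:E)%E by rewrite lee_fin ltW.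
  have mweS := measurable_funTS (D := S) mwe.
  have mgS := measurable_funTS (D := S) mg.
  rewrite -!ge0_integralZl// -ge0_integralD//; last 4 first.
  - by move=> x _; rewrite mule_ge0.
  - exact: measurable_funeM.
  - by move=> x _; rewrite mule_ge0.
  - exact: measurable_funeM.
  rewrite -[leLHS]mul1e -integral_cst//; apply: ge0_le_integral => //.
  - by apply: emeasurable_funD; exact: measurable_funeM.
  - move=> x _ /=; rewrite -EFinM; apply: weight_young => //.
    by rewrite invr_gt0.
case: (eqVneq (\int[mu]_(x in Q) (w x)%:E) 0)%E => [->|/average_gt0 avg0].
  by rewrite mule_ge0// lee_fin mulr_ge0 ?powR_ge0// ltW.
move: HK H sS; rewrite -/g -(fineK muQfin) inver gt_eqF//.
rewrite -(fineK muSfin) -(fineK Wfin) -(fineK afin).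
move: s0; case: (\int[mu]_(x in Q) g x)%E => [s| |//]; last first.
  (* An infinite integral of g would make the A_p product infinite. *)
  move=> _; rewrite gt0_muley ?lte_fin ?invr_gt0// poweRyr ?gt_eqF//.
  by rewrite gt0_muley// -EFinM lte_fin.
rewrite lee_fin => s0; rewrite /= -!EFinM !lee_fin => HK H sS.
apply: (Ap_optimize p1 m0 M0 Mcm (fine_ge0 a0) s0 K0) => // l l0.
rewrite -lee_fin EFinD EFinM; apply: le_trans (H l l0) _.
by rewrite leeD2l// EFinM lee_wpmul2l// lee_fin powR_ge0.
Qed.

(** Writing s for the essential supremum, 1 <= s w almost everywhere on Q,
    hence |S| <= s w(S). *)
Lemma A1_integral_subset :
  (ess_sup mu ((fun x => (w x)%:E^-1) \_ Q) *
    ((mu Q)^-1 * (\int[mu]_(x in Q) (w x)%:E)) <= K%:E)%E ->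
  (\int[mu]_(x in Q) (w x)%:E
    <= (K * c)%:E * \int[mu]_(x in S) (w x)%:E)%E.
Proof.
move=> HK.
case: (eqVneq (\int[mu]_(x in Q) (w x)%:E) 0)%E => [->|/average_gt0 avg0].
  by rewrite mule_ge0// lee_fin mulr_ge0// ltW.
have := @ess_sup_inf.ess_sup_ge _ _ _ mu ((fun x => (w x)%:E^-1) \_ Q)%E.
move: HK; rewrite -(fineK muQfin) -(fineK Wfin) inver gt_eqF//.
case: (ess_sup _ _) => [s| |].
- rewrite -!EFinM lee_fin /= => HK Hs.
  have Hs' : {ae mu, forall x, Q x -> (1 <= s%:E * (w x)%:E)%E}.
    apply: filterS Hs => x + Qx; rewrite patchE mem_set//.
    rewrite inver; case: ifPn => [//|wx0]; rewrite lee_fin => ws.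
    have wx : 0 < w x by rewrite lt_neqAle eq_sym wx0 w0.
    by rewrite -EFinM lee_fin -ler_pdivrMr// mul1r.
  (* The essential supremum runs over a function that is positive on Q, which
     is not a null set. *)
  have s0 : 0 <= s.
    rewrite leNgt; apply/negP => s0.
    have : (mu Q <= 0)%E.
      rewrite -[leLHS]mul1e -integral_cst//.
      rewrite -[leRHS](integral0 mu Q); apply: ae_ge0_le_integral => //.
      apply: filterS Hs' => x /[apply] /le_trans; apply.
      by rewrite -EFinM lee_fin mulr_le0_ge0// ltW.
    by rewrite leNgt muQ0.
  have : (mu S <= s%:E * \int[mu]_(x in S) (w x)%:E)%E.
    rewrite -ge0_integralZl//; last exact: measurable_funTS.
    rewrite -[leLHS]mul1e -integral_cst//; apply: ae_ge0_le_integral => //.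
    + by move=> x _; rewrite mule_ge0.
    + by apply: measurable_funTS; exact: measurable_funeM.
    + by apply: filterS Hs' => x Hx /SQ.
  rewrite -(fineK muSfin) -(fineK afin) -!EFinM !lee_fin => ms.
  exact: (A1_optimize m0 M0 Mcm (fine_ge0 a0) K0 ms HK).
- by rewrite gt0_mulye// -EFinM lte_fin.
- move=> _ HNy; exfalso.
  have : (mu Q <= 0)%E.
    rewrite -[leLHS]mul1e -integral_cst//.
    rewrite -[leRHS](integral0 mu Q); apply: ae_ge0_le_integral => //.
    apply: filterS HNy => x + Qx; rewrite patchE mem_set// leeNy_eq.
    by rewrite inver; case: ifPn.
  by rewrite leNgt muQ0.
Qed.

End weight_on_subset.

(** * Doubling of A_p weights *)

(** The constant uses max(1, A) in order to be positive even for w = 0. *)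
Lemma Ap_doubling (R : realType) (n : nat) (p A c : R) (w : 'rV[R]_n.+1 -> R)
    (x : 'rV[R]_n.+1) (r : R) :
  1 <= p -> Ap p w -> Ap_const p w = A%:E -> 1 <= c -> 0 < r ->
  (wmeasure w (cube x (c * r))
    <= (Num.max 1 A * (2 * c ^+ n.+1) `^ p)%:E * wmeasure w (cube x r))%E.
Proof.
move=> p1 [[w0 mw wloc] _] ApA c1 r0.
have K0 : 0 < Num.max 1 A by rewrite lt_max ltr01.
have c0 : 0 < c by exact: lt_le_trans c1.
have cd1 : 1 <= c ^+ n.+1 by rewrite exprn_ege1.
have we0 y : (0 <= (w y)%:E)%E by rewrite lee_fin.
have muQS := cube_measure_scale x r c0.
have mS := measurable_cube x r; have mQ := measurable_cube x (c * r).
have SQ : cube x r `<=` cube x (c * r).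
  have rcr : r <= c * r by rewrite ler_peMl// ltW.
  by move=> y xy i; have /= /andP[? ?] := xy i; lra.
rewrite /wmeasure.
(* By scaling, a null cube has null dilates. *)
have [muS0|muS0] := eqVneq (lebesgue R n (cube x r)) 0%E.
  move: muQS; rewrite muS0 mule0 => muQ0.
  have {muQ0}muQ0 : lebesgue R n (cube x (c * r)) = 0%E.
    by apply/eqP; rewrite eq_le muQ0 measure_ge0.
  rewrite null_set_integral//; last by apply: measurable_funTS; exact/measurable_EFinP.
  by rewrite mule_ge0 ?integral_ge0// lee_fin mulr_ge0 ?powR_ge0// ltW.
have {}muS0 : (0 < lebesgue R n (cube x r))%E by rewrite lt_neqAle eq_sym muS0 measure_ge0.
have muQy := cube_measure_lty x (c * r).
have Wy : (\int[lebesgue R n]_(y in cube x (c * r)) (w y)%:E < +oo)%E.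
  have := wloc _ (@compact_cube _ _ x (c * r)).
  by under eq_integral do rewrite ger0_norm//.
have Q_cube := cube_cubes x (mulr_gt0 c0 r0).
have AK : (A%:E <= (Num.max 1 A)%:E)%E by rewrite lee_fin le_max lexx orbT.
move: ApA; rewrite /Ap_const; case: ifPn => [/eqP p1'|p1'] ApA.
  apply: (@le_trans _ _ ((Num.max 1 A * c ^+ n.+1)%:E *
      \int[lebesgue R n]_(y in cube x r) (w y)%:E)%E).
    apply: A1_integral_subset => //; apply: le_trans AK; rewrite -ApA.
    by apply: ereal_sup_ubound; exists (cube x (c * r)).
  apply: lee_wpmul2r; first exact: integral_ge0.
  rewrite lee_fin ler_wpM2l// ?(ltW K0)// p1' powRr1; lra.
apply: Ap_integral_subset => //; first by rewrite lt_neqAle eq_sym p1'.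
apply: le_trans AK; rewrite -ApA.
by apply: ereal_sup_ubound; exists (cube x (c * r)).
Qed.

(** * Vitali covering *)

(** Vitali's selection for arbitrary sets B i with sizes r i.  Zorn's lemma is
    applied to the disjoint subfamilies G such that every member of V meeting
    some member of G meets one of at least half its size.  If a maximal G missed
    some members of V entirely, one of these with size more than half of the
    supremum of their sizes could be added to G. *)
Lemma vitali_selection (R : realType) (I T : Type) (B : I -> set T)
    (r : I -> R) (M : R) (V : set I) :
  (forall i, V i -> 0 < r i <= M) -> (forall i, V i -> B i !=set0) ->
  exists D : set I, [/\ D `<=` V, trivIset D B &
    forall i, V i -> exists j, [/\ D j, B i `&` B j !=set0 & r i <= 2 * r j]].
Proof.
move=> rM B0.
pose P := [set G : set I | [/\ G `<=` V, trivIset G B &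
  forall i, V i -> (exists2 j, G j & B i `&` B j !=set0) ->
    exists j, [/\ G j, B i `&` B j !=set0 & r i <= 2 * r j]]].
have [F FP Ftot|G [[GV tG GP] Gmax]] := @Zorn_bigcup I P.
  split.
  - by move=> i [X FX Xi]; have [+ _ _] := FP _ FX; exact.
  - move=> i j [X FX Xi] [Y FY Yj]; have [_ tX _] := FP _ FX.
    have [_ tY _] := FP _ FY.
    by have [XY|YX] := Ftot _ _ FX FY; [exact: tY (XY _ Xi) Yj|exact: tX Xi (YX _ Yj)].
  - move=> i Vi [j [X FX Xj] ij]; have [_ _ XP] := FP _ FX.
    have [|k [Xk ik rik]] := XP i Vi; first by exists j.
    by exists k; split => //; exists X.
exists G; split => // i Vi; apply: (GP) => //; apply: contrapT => iG.
pose V' := [set k | V k /\ forall j, G j -> B k `&` B j = set0].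
have V'i : V' i.
  split => // j Gj; apply: contrapT => /eqP/set0P ij.
  by apply: iG; exists j.
have supV' : has_sup (r @` V').
  split; first by exists (r i), i.
  by exists M => _ [k [Vk _] <-]; have /andP[] := rM _ Vk.
have s0 : 0 < sup (r @` V').
  have /andP[ri0 _] := rM _ Vi; apply: lt_le_trans ri0 _.
  by apply: sup_upper_bound => //; exists i.
have [_ [k [Vk kG] <-]] := sup_adherent (divr_gt0 s0 (ltr0Sn _ 1)) supV'.
move=> rk; apply: (Gmax (G `|` [set k])).
  split; first by left.
  move=> /(_ k (or_intror erefl)) Gk.
  by have /set0P := B0 _ Vk; rewrite -(setIid (B k)) kG// eqxx.
split.
- by move=> j [/GV//|->].
- move=> j l [Gj|->] [Gl|->] //; first exact: tG.
  + by rewrite setIC kG// => -[].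
  + by rewrite kG// => -[].
- move=> j Vj [l Gl jl].
  have [jG|jG] := pselect (exists2 l, G l & B j `&` B l !=set0).
    by have [m [Gm jm rjm]] := GP j Vj jG; exists m; split => //; left.
  case: Gl jl => [Gl jl|-> jk]; first by case: jG; exists l.
  exists k; split => //; first by right.
  have : r j <= sup (r @` V').
    apply: sup_upper_bound => //; exists j => //; split => // m Gm.
    by apply: contrapT => /eqP/set0P jm; apply: jG; exists m.
  lra.
Qed.

(** Each cube contains a point with rational coordinates. *)
Lemma trivIset_cube_countable (R : realType) (n : nat)
    (D : set 'rV[R]_n.+1) (r : 'rV[R]_n.+1 -> R) :
  (forall x, D x -> 0 < r x) -> trivIset D (fun x => cube x (r x)) ->
  countable D.
Proof.
move=> r0 tD.
have ratP x : D x -> exists q : 'rV[rat]_n.+1, cube x (r x) (map_mx ratr q).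
  move=> Dx.
  have xr i : x ord0 i - r x < x ord0 i + r x by have := r0 _ Dx; lra.
  have /choice[q qP] : forall i, exists q : rat,
      ratr q \in `]x ord0 i - r x, x ord0 i + r x[.
    by move=> i; have [q ?] := rat_in_itvoo (xr i); exists q.
  exists (\row_i q i) => i; have := qP i.
  by rewrite !mxE in_itv/= => /andP[/ltW -> /ltW ->].
pose Q x q := D x -> cube x (r x) (map_mx ratr q).
have /choice[f fP] : forall x, exists q : 'rV[rat]_n.+1, Q x q.
  move=> x; have [Dx|Dx] := pselect (D x); last by exists 0.
  by have [q ?] := ratP x Dx; exists q.
apply/countable_injP; exists (pickle \o f) => x y; rewrite !inE => Dx Dy.
move=> /(pcan_inj pickleK) fxy; apply: tD => //.
by exists (map_mx ratr (f x)); split; [exact: fP|rewrite fxy; exact: fP].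
Qed.

(** * Euclidean balls and oscillation *)

Lemma coord_le_enorm (R : realType) (n : nat) (v : 'rV[R]_n.+1) i :
  `|v ord0 i| <= enorm v.
Proof.
rewrite /enorm -sqrtr_sqr ler_wsqrtr// (bigD1 i)//= lerDl.
by apply: sumr_ge0 => j _; exact: sqr_ge0.
Qed.

Lemma enorm_le (R : realType) (n : nat) (v : 'rV[R]_n.+1) (s : R) :
  (forall i, `|v ord0 i| <= s) -> enorm v <= n.+1%:R * s.
Proof.
move=> vs; have s0 : 0 <= s by apply: le_trans (vs ord0).
have ns0 : 0 <= n.+1%:R * s by rewrite mulr_ge0.
rewrite -[leRHS]ger0_norm// -sqrtr_sqr /enorm ler_wsqrtr//.
apply: (@le_trans _ _ (\sum_(i < n.+1) s ^+ 2)).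
  apply: ler_sum => i _; rewrite -(real_normK (num_real _)) lerXn2r ?nnegrE//.
rewrite sumr_const card_ord exprMn -[s ^+ 2 *+ _]mulr_natl ler_wpM2r ?sqr_ge0//.
by rewrite -natrX ler_nat leq_pmulr.
Qed.

Lemma enorm_gt0 (R : realType) (n : nat) (v : 'rV[R]_n.+1) :
  v != 0 -> 0 < enorm v.
Proof.
move=> v0; have [i vi] : exists i, v ord0 i != 0.
  by have /rV0Pn := v0.
by apply: lt_le_trans (coord_le_enorm v i); rewrite normr_gt0.
Qed.

Lemma eball_sub_cube (R : realType) (n : nat) (x : 'rV[R]_n.+1) (r : R) :
  eball (x, r) `<=` cube x r.
Proof.
move=> y /= xy i; have := le_lt_trans (coord_le_enorm _ i) xy.
by rewrite /= !mxE ltr_norml => /andP[? ?]; lra.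
Qed.

Lemma cube_sub_eball (R : realType) (n : nat) (x : 'rV[R]_n.+1) (r : R) :
  0 < r -> cube x (r / (2 * n.+1%:R)) `<=` eball (x, r).
Proof.
move=> r0 y xy; rewrite /eball /=.
have /enorm_le/le_lt_trans : forall i, `|(x - y) ord0 i| <= r / (2 * n.+1%:R).
  move: (r / (2 * n.+1%:R)) xy => s xy i; rewrite !mxE ler_norml.
  by have /andP[? ?] := xy i; lra.
apply; rewrite [ltLHS](_ : _ = r / 2); last by field; rewrite nat1r pnatr_eq0.
lra.
Qed.

(** The radius 2 |x - y| puts y inside the open ball, at the cost of the
    factor 2 in the bound t / 2.  Taking y in the sup-norm unit ball keeps the radii bounded,
    as [vitali_selection] requires. *)
Lemma osc_eball_ge (R : realType) (n : nat) (f : 'rV[R]_n.+1 -> R)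
    (x : 'rV[R]_n.+1) (t : R) : 0 < t -> (t%:E < local_lip f x)%E ->
  exists2 r, 0 < r <= 2 * n.+1%:R &
    ((t / 2)%:E <= osc f (eball (x, r)) / r%:E)%E.
Proof.
move=> t0; rewrite /local_lip /limf_esup => tL.
have /(lt_le_trans tL) : (ereal_inf [set ereal_sup ((fun y : 'rV[R]_n.+1 =>
    (`|f x - f y| / enorm (x - y))%:E) @` A) | A in x^'] <=
    ereal_sup ((fun y : 'rV[R]_n.+1 => (`|f x - f y| / enorm (x - y))%:E) @`
      (ball x 1 `\ x)))%E.
  apply: ereal_inf_lbound; exists (ball x 1 `\ x) => //.
  apply: dnbhs_ball => //.
move=> /ereal_sup_gt[_ [y [xy yx] <-]]; rewrite lte_fin => txy.
have exy0 : 0 < enorm (x - y).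
  by apply: enorm_gt0; rewrite subr_eq0 eq_sym; apply/eqP.
exists (2 * enorm (x - y)).
  rewrite mulr_gt0//= ler_pM2l// -[leRHS]mulr1; apply: enorm_le => i.
  by have [_ /(_ ord0 i)] := xy; rewrite /ball/= !mxE => /ltW.
rewrite inver gt_eqF ?mulr_gt0//.
apply: (@le_trans _ _ ((`|f x - f y|)%:E * ((2 * enorm (x - y))^-1)%:E)%E).
  rewrite -EFinM lee_fin ler_pdivlMr ?mulr_gt0//.
  by move: txy; rewrite ltr_pdivlMr//; lra.
apply: lee_wpmul2r; first by rewrite lee_fin invr_ge0 mulr_ge0// ltW.
apply: ereal_sup_ubound; exists (x, y) => //; split; rewrite /eball /=.
  rewrite subrr /enorm big1 ?sqrtr0 ?mulr_gt0// => i _.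
  by rewrite mxE expr0n.
by rewrite ltr_pMl// ltr1n.
Qed.

(** * The weak-type estimate *)

Lemma esumZl_le (R : realType) (T : choiceType) (D : set T) (a : T -> \bar R)
    (c : R) : 0 <= c -> (forall i, 0 <= a i)%E ->
  (\esum_(i in D) (c%:E * a i) <= c%:E * \esum_(i in D) a i)%E.
Proof.
move=> c0 a0; apply: ge_ereal_sup => _ [X DX <-].
rewrite -ge0_mule_fsumr//; apply: lee_wpmul2l; first by rewrite lee_fin.
by apply: esum_ge; exists X.
Qed.

Lemma esum_le_riesz_variation (R : realType) (n : nat) (p : R)
    (w f : 'rV[R]_n.+1 -> R) (D : set ('rV[R]_n.+1 * R)) :
  0 < p -> (forall x, 0 <= w x) -> ball_families D ->
  (\esum_(b in D) ((osc f (eball b) / (b.2)%:E) `^ p * wmeasure w (eball b))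
    <= riesz_variation p w f `^ p)%E.
Proof.
move=> p0 w0 DB; set s := (\esum_(b in D) _)%E.
have s0 : (0 <= s)%E.
  apply: esum_ge0 => b _; rewrite mule_ge0 ?poweR_ge0//.
  by apply: integral_ge0 => x _; rewrite lee_fin.
rewrite -[leLHS]poweRe1// -(mulVf (lt0r_neq0 p0)) poweRrM.
have sV : (s `^ p^-1 <= riesz_variation p w f)%E.
  by apply: ereal_sup_ubound; exists D.
apply: gt0_ler_poweR => //; first exact: ltW.
- by rewrite in_itv/= poweR_ge0 leey.
- by rewrite in_itv/= leey andbT (le_trans _ sV)// poweR_ge0.
Qed.

Theorem theorem1p5 (R : realType) (n : nat) (p : R) (A : R) :
  1 <= p ->
  exists C : R, 0 < C /\
    forall w f : 'rV[R]_n.+1 -> R,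
      Ap p w -> Ap_const p w = A%:E -> RBV p w f ->
      forall t : R, 0 < t ->
        (wmeasure w [set x | t%:E < local_lip f x]
          <= C%:E * (riesz_variation p w f / t%:E) `^ p)%E.
Proof.
move=> p1; have p0 : 0 < p by exact: lt_le_trans p1.
(* c is the ratio of the half-sides 3 r and r / (2 (n + 1)): the dilated Vitali
   cube and the cube inscribed in the Euclidean ball of radius r. *)
pose c : R := 6 * n.+1%:R.
have c1 : 1 <= c by rewrite /c mulr_ege1// ler1n.
pose K := Num.max 1 A * (2 * c ^+ n.+1) `^ p.
have K0 : 0 < K.
  rewrite mulr_gt0 ?lt_max ?ltr01// powR_gt0// mulr_gt0// exprn_gt0//.
  exact: lt_le_trans c1.
exists (K * 2 `^ p); split; first by rewrite mulr_gt0// powR_gt0.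
move=> w f wAp ApA _ t t0; have [[w0 mw _] _] := wAp.
have we0 x : (0 <= (w x)%:E)%E by rewrite lee_fin.
set E := [set x | _].
pose P x r := E x -> 0 < r <= 2 * n.+1%:R /\
  ((t / 2)%:E <= osc f (eball (x, r)) / r%:E)%E.
have /choice[r rP] : forall x, exists r, P x r.
  move=> x; have [Ex|Ex] := pselect (E x); last by exists 0.
  by have [r r0 rosc] := osc_eball_ge t0 Ex; exists r.
have r0 x : E x -> 0 < r x by move=> /rP[/andP[]].
have E0 x : E x -> cube x (r x) !=set0.
  by move=> /r0 rx0; exists x => i; lra.
have [D [DE tD DP]] := vitali_selection (fun x Ex => (rP x Ex).1) E0.
have Ecover : E `<=` \bigcup_(x in D) cube x (3 * r x).
  move=> x Ex; have [y [Dy [z [xz yz]] rxy]] := DP x Ex.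
  exists y => // i; have /= /andP[? ?] := xz i; have /= /andP[? ?] := yz i.
  lra.
have Dcount : countable D.
  by apply: trivIset_cube_countable tD => x /DE/r0.
pose e (x : 'rV[R]_n.+1) := (x, r x).
have De : ball_families (e @` D).
  split; first exact: sub_countable (card_image_le _ _) Dcount.
    by move=> _ [x /DE/r0 ? <-].
  move=> _ _ [x Dx <-] [y Dy <-] [z [xz yz]]; congr e; apply: tD => //.
  by exists z; split; exact: eball_sub_cube.
apply: (@le_trans _ _ (\esum_(x in D) wmeasure w (cube x (3 * r x)))%E).
  apply: integral_bigcup_le_esum => //; first by move=> x; exact: measurable_cube.
  exact/measurable_EFinP.
pose a (b : 'rV[R]_n.+1 * R) :=
  ((osc f (eball b) / (b.2)%:E) `^ p * wmeasure w (eball b))%E.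
have a0 b : (0 <= a b)%E by rewrite mule_ge0 ?poweR_ge0// integral_ge0.
have t20 : 0 < t / 2 by rewrite divr_gt0.
have wa x : D x ->
    (wmeasure w (cube x (3 * r x)) <= (K * (t / 2) `^ (- p))%:E * a (e x))%E.
  move=> Dx; have rx0 := r0 _ (DE _ Dx); have [_ rosc] := rP _ (DE _ Dx).
  have -> : 3 * r x = c * (r x / (2 * n.+1%:R)).
    by rewrite /c; field; rewrite nat1r pnatr_eq0.
  apply: le_trans (Ap_doubling _ p1 wAp ApA c1 _) _.
    by rewrite divr_gt0// mulr_gt0.
  rewrite (EFinM K) -muleA lee_wpmul2l ?lee_fin ?(ltW K0)//.
  apply: (@le_trans _ _ (wmeasure w (eball (e x)))).
    rewrite /wmeasure integral_mkcond [leRHS]integral_mkcond.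
    apply: le_integral_nonneg => y; rewrite !patchE; first by case: ifPn.
    case: ifPn => [|_]; last by case: ifPn.
    by rewrite inE => /(cube_sub_eball rx0) yB; rewrite mem_set.
  rewrite powRN lee_pdivlMl ?powR_gt0// -poweR_EFin.
  apply: lee_wpmul2r; first exact: integral_ge0.
  apply: gt0_ler_poweR => //; first exact: ltW.
  - by rewrite in_itv/= leey andbT lee_fin ltW.
  - by rewrite in_itv/= leey andbT (le_trans _ rosc)// lee_fin ltW.
apply: (@le_trans _ _ (\esum_(x in D) ((K * (t / 2) `^ (- p))%:E * a (e x)))%E).
  by apply: le_esum.
have k0 : 0 <= K * (t / 2) `^ (- p) by rewrite mulr_ge0 ?powR_ge0// ltW.
apply: le_trans (esumZl_le _ k0 (fun x => a0 (e x))) _.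
rewrite -(@reindex_esum _ _ _ D (e @` D) e a); last first.
  by split => // x y _ _ [].
have V0 : (0 <= riesz_variation p w f)%E.
  apply: le_trans (ereal_sup_ubound _); last by exists (e @` D).
  exact: poweR_ge0.
apply: (@le_trans _ _ ((K * (t / 2) `^ (- p))%:E *
    riesz_variation p w f `^ p)%E).
  apply: lee_wpmul2l; first by rewrite lee_fin.
  exact: (esum_le_riesz_variation f p0 w0 De).
rewrite inver gt_eqF// poweRM// ?lee_fin ?invr_ge0 ?(ltW t0)// poweR_EFin.
rewrite [(_ * (_%:E))%E in leRHS]muleC muleA -EFinM.
rewrite [X in (X%:E * _ <= _)%E](_ : _ = K * 2 `^ p * t^-1 `^ p)//.
rewrite -mulrA -powRM ?invr_ge0 ?(ltW t0)// -(powR_inv _ (ltW t20)) invf_div//.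
Qed.
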